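(* Let $\alpha_1<\alpha_2<\alpha_3$ be real numbers, let $\rho_1,\rho_2,\rho_3>0$ be real numbers, and let $k$ be a positive integer. Write the Van Vleck zeros of order $k$ in increasing order as $\nu_1^{(k)}<\nu_2^{(k)}<\cdots<\nu_{k+1}^{(k)}$, and those of order $k+1$ in increasing order as $\nu_1^{(k+1)}<\nu_2^{(k+1)}<\cdots<\nu_{k+2}^{(k+1)}$. Then $$\alpha_1<\nu_1^{(k+1)}<\nu_1^{(k)}<\nu_2^{(k+1)}<\nu_2^{(k)}<\cdots<\nu_{k+1}^{(k)}<\nu_{k+2}^{(k+1)}<\alpha_3 .$$ In other words, the Van Vleck zeros of order $k$ and $k+1$ interlace: between any two consecutive Van Vleck zeros of order $k$ there is a Van Vleck zero of order $k+1$, and vice versa.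
   Context: Given real $\alpha_1<\alpha_2<\alpha_3$ and real $\rho_1,\rho_2,\rho_3>0$, set $$A(x)=\prod_{j=1}^3(x-\alpha_j),\qquad B(x)=\sum_{j=1}^3 2\rho_j\prod_{i\neq j}(x-\alpha_i).$$ The Lamé equation is $A(x)\phi''+B(x)\phi'=\mu(x-\nu)\phi$. For an integer $k\ge 1$, the Van Vleck zeros of order $k$ are all the numbers $\nu$ such that, for some constant $\mu$, this equation has a polynomial solution $\phi$ of degree exactly $k$ (necessarily $\mu=k(k-1+2(\rho_1+\rho_2+\rho_3))$). It is a known fact (Heine, Van Vleck) that there are exactly $k+1$ distinct Van Vleck zeros of order $k$, and that they are all real and lie in $(\alpha_1,\alpha_3)$. *)

(* Defs.v *)
From mathcomp Require Import all_boot all_order all_algebra.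
From mathcomp Require Import reals complex.

Set Implicit Arguments.
Unset Strict Implicit.
Unset Printing Implicit Defensive.

Import Order.TTheory GRing.Theory Num.Theory.

Local Open Scope ring_scope.
Local Open Scope complex_scope.

Section Lame.
Variable F : comNzRingType.
Implicit Types (alpha rho : 'I_3 -> F) (mu nu : F) (phi : {poly F}).

Definition lameA alpha : {poly F} := \prod_(j < 3) ('X - (alpha j)%:P).

Definition lameB alpha rho : {poly F} :=
  \sum_(j < 3) (2 * rho j)%:P * \prod_(i < 3 | i != j) ('X - (alpha i)%:P).

Definition lame_equation alpha rho mu nu phi : Prop :=
  lameA alpha * phi^`(2) + lameB alpha rho * phi^`()
    = mu *: (('X - nu%:P) * phi).

Definition van_vleck_zero alpha rho (k : nat) nu : Prop :=
  exists (mu : F) (phi : {poly F}),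
    size phi = k.+1 /\ lame_equation alpha rho mu nu phi.

End Lame.

(* nu lists, in increasing order, all the complex Van Vleck zeros of order k
   of the Lame equation with real data alpha, rho; in particular this says
   that they are all real and that there are exactly k + 1 of them. *)
Definition van_vleck_enum (R : realType) (alpha rho : 'I_3 -> R) (k : nat)
    (nu : 'I_k.+1 -> R) : Prop :=
  (forall i j : 'I_k.+1, (i < j)%N -> nu i < nu j) /\
  (forall z : R[i],
     van_vleck_zero (fun j => (alpha j)%:C) (fun j => (rho j)%:C) k z
     <-> exists i : 'I_k.+1, z = (nu i)%:C).

(* Main.v *)
Require Import Defs.
From mathcomp Require Import all_boot all_order all_algebra.
From mathcomp Require Import reals complex polyrcf ring lra.

(** Why the theorem holds.

    Existence.  In powers of [x - alpha_2], with [alpha_2] the middle singular point,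
    the Lame operator on polynomials of degree at most [k] is a tridiagonal matrix
    whose opposite off-diagonal entries have a positive product
    ([lame_equation_three_term]).  Hence [nu] is a Van Vleck zero if and only if
    [mu * (nu - alpha_2)] is a root of the last member of a finite family of orthogonal
    polynomials ([van_vleck_zero_root]), and by the Christoffel-Darboux identity these
    roots are real and simple ([orthpoly_real_roots]).  This gives exactly [k + 1] Van
    Vleck zeros, all real.

    Interlacing.  Divide the equation by [mu]: it becomes
    [(p phi' / mu)' + p (nu - x) / A * phi = 0] with [p' / p = B / A].  On the left
    interval, where [A > 0], increasing [mu] decreases the leading coefficient and
    increasing [nu] increases the potential, so by the Sturm-Picone comparison theorem
    ([sturm_picone]) either change produces at least one more zero there.  On the right
    interval [A < 0], and it is decreasing [nu] that produces zeros.  Comparing the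
    Van Vleck zeros of one order with each other shows that the solution for the [i]-th
    of them, counted from zero, has at least [i] zeros on the left and at least [k - i]
    on the right.  Comparing the orders [k] and [k + 1], any violation of the
    interlacing inequalities would give a solution of degree [k + 1] with [k + 2]
    zeros.  The bounds [alpha_1 < nu < alpha_3] come from a comparison with the constant
    solution of the equation with zero potential.

    The comparison theorem is proved by algebra alone.  The weight [p] involves
    arbitrary real powers, but it serves only to turn an inequality
    [A W' + D W >= 0] into monotonicity.  For polynomials the same information is read
    off the leading order of [W] at a zero of [W] or at an end point
    ([gt0_right_of_end]): this works at the singular points and at common zeros of the
    two solutions, and it requires no strict inequality. *)

Set Implicit Arguments.
Unset Strict Implicit.
Unset Printing Implicit Defensive.

Import Order.TTheory GRing.Theory Num.Theory.

Local Open Scope ring_scope.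

(** * Leading order of a polynomial at a point *)

Section LocalSigns.
Variable R : rcfType.
Implicit Types (p g h A B C D E L W : {poly R}) (a b t x : R).

Lemma exists_nonroot p a b : p != 0 -> a < b ->
  exists x, [/\ a < x, x < b, ~~ root p x
              & forall y, a < y -> y <= x -> ~~ root p y].
Proof.
move=> p0 ab; have gta := next_root_gt ab p0.
have leb : next_root p a b <= b.
  by have := next_root_in p a b; rewrite in_itv /= max_l ?(ltW ab) // => /andP[].
have [? ?] := midf_lt gta.
exists ((a + next_root p a b) / 2).
have nr y : a < y -> y <= (a + next_root p a b) / 2 -> ~~ root p y.
  by move=> ay yx; apply: (@next_noroot _ p a b); rewrite in_itv /= ay /=; lra.
split=> //; [lra | exact: nr].
Qed.

Lemma horner_ge0_left_end p a b : a < b ->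
  (forall x, a < x -> x < b -> 0 <= p.[x]) -> 0 <= p.[a].
Proof.
move=> ab pge0; rewrite leNgt; apply/negP => pa0.
have p0 : p != 0 by apply: contraTneq pa0 => ->; rewrite horner0 ltxx.
have [x [ax xb nrx nr]] := exists_nonroot p0 ab.
have px : 0 < p.[x] by rewrite lt_neqAle eq_sym; apply/andP; split; auto.
have [|y] := @poly_ivtoo _ p a x (ltW ax); first by rewrite nmulr_rlt0.
by rewrite in_itv /= => /andP[ay yx]; apply/negP/nr => //; apply: ltW.
Qed.

Lemma horner_deriv_mulXsubC g t : (g * ('X - t%:P))^`().[t] = g.[t].
Proof.
by rewrite derivM derivXsubC mulr1 hornerD hornerM hornerXsubC subrr mulr0 add0r.
Qed.

Lemma XsubC_deriv_exp g t m :
  ('X - t%:P) * (g * ('X - t%:P) ^+ m)^`()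
    = (('X - t%:P) * g^`() + g *+ m) * ('X - t%:P) ^+ m.
Proof.
rewrite derivM deriv_exp derivXsubC mul1r.
move: ('X - _) g^`() => Z g'; case: m => [|m] /=; first by rewrite !mulr0n; ring.
rewrite -[_ *+ m.+1]mulr_natr -[g *+ _]mulr_natr; move: (m.+1%:R) => c.
by rewrite exprS; ring.
Qed.

(** Read at its leading order at [t], the inequality says that [C m + D] times
    the leading coefficient of [W] is nonnegative, [m] being the order of
    vanishing of [W] at [t].  This replaces an integrating factor: the
    coefficients may be singular at [t], where such a factor would be an
    arbitrary real power of the distance to [t]. *)
Lemma gt0_right_of_end C D W t b : W != 0 -> t < b ->
    (forall x, t < x -> x < b -> ~~ root W x) ->
    (forall x, t < x -> x < b ->
       0 <= (x - t) * C.[x] * W^`().[x] + D.[x] * W.[x]) ->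
    (forall m g, W = g * ('X - t%:P) ^+ m -> ~~ root g t ->
       0 < C.[t] * m%:R + D.[t]) ->
  forall x, t < x -> x < b -> 0 < W.[x].
Proof.
move=> W0 tb nr ineq pos x tx xb.
have [m [g]] := multiplicity_XsubC W t; rewrite W0 /= => ngt Wg.
have {}pos := pos _ _ Wg ngt.
have sgW y : W.[y] = g.[y] * (y - t) ^+ m by rewrite Wg !hornerE.
have pw y : t < y -> 0 < (y - t) ^+ m by move=> ty; rewrite exprn_gt0 // subr_gt0.
(* [E] is the right-hand side of the inequality divided by [('X - t) ^+ m]. *)
pose E := C * (('X - t%:P) * g^`() + g *+ m) + D * g.
have Et : E.[t] = (C.[t] * m%:R + D.[t]) * g.[t].
  by rewrite /E !hornerE hornerMn subrr mul0r add0r -mulr_natr; ring.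
have : 0 <= E.[t].
  apply: (horner_ge0_left_end tb) => y ty yb.
  rewrite -(pmulr_lge0 _ (pw y ty)); have := ineq y ty yb.
  have -> : (y - t) * C.[y] * W^`().[y] = C.[y] * (('X - t%:P) * W^`()).[y].
    by rewrite hornerM hornerXsubC; ring.
  rewrite sgW Wg XsubC_deriv_exp /E.
  rewrite !(hornerXsubC, hornerM, hornerD, hornerMn, horner_exp).
  by congr (_ <= _); ring.
rewrite Et pmulr_rge0 // => gt0.
have {}gt0 : 0 < g.[t] by rewrite lt_neqAle eq_sym gt0 andbT.
rewrite sgW pmulr_lgt0 ?pw // ltNge le_eqVlt; apply/negP => /orP[gx|gx].
  by have := nr x tx xb; rewrite rootE sgW (eqP gx) mul0r eqxx.
have [|y] := @poly_ivtoo _ g t x (ltW tx); first by rewrite pmulr_rlt0.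
rewrite in_itv /= => /andP[ty yx] /rootP gy.
by have := nr y ty (lt_trans yx xb); rewrite rootE sgW gy mul0r eqxx.
Qed.

(** The indicial equation: only the two exponents [0] and [1 - D/C] are possible
    at a point [t] where the second order equation is regular singular, so that
    a nonzero exponent [n + 1] satisfies the linear equation below. *)
Lemma frobenius_exponent C D E g t n :
    let p := g * ('X - t%:P) ^+ n.+1 in
    ('X - t%:P) * C * p^`(2) + D * p^`() = E * p -> ~~ root g t ->
  n%:R * C.[t] + D.[t] = 0.
Proof.
move=> p eqp ngt; set Z := 'X - t%:P in p eqp *.
pose q1 := Z * g^`() + g *+ n.+1.
have Z0 : Z != 0 by rewrite polyXsubC_eq0.
have p1 : p^`() = q1 * Z ^+ n.
  by apply: (mulfI Z0); rewrite XsubC_deriv_exp exprS; rewrite -/Z -/q1; ring.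
have p2 : Z * p^`(2) = (Z * q1^`() + q1 *+ n) * Z ^+ n.
  by rewrite -XsubC_deriv_exp -p1 derivSn derivn1.
have : C * (Z * q1^`() + q1 *+ n) + D * q1 = E * g * Z.
  apply: (mulIf (expf_neq0 n Z0)); rewrite mulrDl -!mulrA -p2 -p1 mulrCA mulrA.
  by rewrite -exprS eqp.
move/(congr1 (fun q => q.[t])); rewrite /q1 /Z !(hornerE, hornerMn) subrr.
rewrite !(mul0r, add0r, mulr0) => /eqP.
have -> : C.[t] * (g.[t] *+ n.+1 *+ n) + D.[t] * (g.[t] *+ n.+1)
   = (n%:R * C.[t] + D.[t]) * (g.[t] * n.+1%:R).
  by rewrite -(mulr_natr _ n) -(mulr_natr _ n.+1); ring.
by rewrite !mulf_eq0 -[g.[t] == 0]/(root g t) (negPf ngt) pnatr_eq0 /= orbF => /eqP.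
Qed.

End LocalSigns.

(** * Picone's identity for two solutions *)

(** The two kinds of end point of a comparison interval: a regular singular point
    of the equation, with the signs that the Lame equation has there, or a zero of
    the solution being compared. *)
Definition left_end (R : rcfType) (A B p : {poly R}) (a : R) :=
  [/\ A.[a] = 0, 0 < A^`().[a] & 0 < B.[a]] \/ 0 < A.[a] /\ p.[a] = 0.

Definition right_end (R : rcfType) (A B p : {poly R}) (b : R) :=
  [/\ A.[b] = 0, A^`().[b] < 0 & B.[b] < 0] \/ 0 < A.[b] /\ p.[b] = 0.

(** Up to the factor [mu * mu'], this is [(phi'/mu) psi - phi (psi'/mu')].  Dividing
    the equation by [mu] moves this parameter from the potential to the leading
    coefficient, and Picone's comparison then needs the fluxes [phi'/mu] in place
    of the derivatives. *)
Definition scaled_wronskian (R : rcfType) (mu mu' : R) (phi psi : {poly R}) :=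
  mu' *: (phi^`() * psi) - mu *: (phi * psi^`()).

Definition sturm_eq (R : rcfType) (A B L : {poly R}) mu p :=
  A * p^`(2) + B * p^`() = mu *: (L * p).

Section Picone.
Variables (R : rcfType) (A B L L' phi psi : {poly R}) (mu mu' a b : R).
Hypotheses (mu_gt0 : 0 < mu) (mu_le : mu <= mu') (ab : a < b).
Hypothesis A_gt0 : forall x, a < x -> x < b -> 0 < A.[x].
Hypothesis L_le : forall x, a < x -> x < b -> L'.[x] <= L.[x].
Hypothesis phi_gt0 : forall x, a < x -> x < b -> 0 < phi.[x].
Hypothesis psi_gt0 : forall x, a < x -> x < b -> 0 < psi.[x].
Hypothesis phi_eq : sturm_eq A B L mu phi.
Hypothesis psi_eq : sturm_eq A B L' mu' psi.

Let W := scaled_wronskian mu mu' phi psi.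
Let D := mu' *: (B * psi) - (mu' - mu) *: (A * psi^`()).

Lemma scaled_wronskianE x :
  W.[x] = mu' * (phi^`().[x] * psi.[x]) - mu * (phi.[x] * psi^`().[x]).
Proof. by rewrite /W /scaled_wronskian !(hornerD, hornerN, hornerZ, hornerM). Qed.

Lemma picone_coefE x :
  D.[x] = mu' * (B.[x] * psi.[x]) - (mu' - mu) * (A.[x] * psi^`().[x]).
Proof. by rewrite /D !(hornerD, hornerN, hornerZ, hornerM). Qed.

Lemma deriv_scaled_wronskianE x :
  W^`().[x] = mu' * (phi^`(2).[x] * psi.[x] + phi^`().[x] * psi^`().[x])
            - mu * (phi^`().[x] * psi^`().[x] + phi.[x] * psi^`(2).[x]).
Proof.
rewrite /W /scaled_wronskian derivB !derivZ !derivM !(derivSn, derivn0).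
by rewrite !(hornerD, hornerN, hornerZ, hornerM).
Qed.

(** Picone's identity, cleared of denominators.  The first order operator on the
    left comes from substituting [phi' = (W + mu phi psi') / (mu' psi)] into the
    derivative of [W], which turns [phi' psi'] into a multiple of the square of
    [psi'].  For [mu = mu'] this is the classical Wronskian identity of Sturm. *)
Lemma picone_identity x :
  A.[x] * (mu' * psi.[x]) * W^`().[x] + D.[x] * W.[x]
  = mu * mu' ^+ 2 * (L.[x] - L'.[x]) * phi.[x] * psi.[x] ^+ 2
    + (mu' - mu) * mu * A.[x] * phi.[x] * psi^`().[x] ^+ 2.
Proof.
have /(congr1 (fun p => p.[x])) := phi_eq.
have /(congr1 (fun p => p.[x])) := psi_eq.
rewrite scaled_wronskianE deriv_scaled_wronskianE picone_coefE.
rewrite !(hornerD, hornerZ, hornerM).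
move: A.[x] B.[x] L.[x] L'.[x] phi.[x] phi^`().[x] phi^`(2).[x] => vA vB l l' f f1 f2.
move: psi.[x] psi^`().[x] psi^`(2).[x] => g g1 g2 Eg Ef.
transitivity (mu' ^+ 2 * g ^+ 2 * (vA * f2 + vB * f1)
   - mu * mu' * g * f * (vA * g2 + vB * g1)
   + (mu' - mu) * mu * vA * f * g1 ^+ 2); first by ring.
by rewrite Ef Eg; ring.
Qed.

Lemma picone_ge0 x : a < x -> x < b ->
  0 <= A.[x] * (mu' * psi.[x]) * W^`().[x] + D.[x] * W.[x].
Proof.
move=> ax xb; rewrite picone_identity.
have := A_gt0 ax xb; have := phi_gt0 ax xb; have := L_le ax xb => hL hp hA.
have mu'0 : 0 < mu' := lt_le_trans mu_gt0 mu_le.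
move: (psi^`().[x] ^+ 2) (sqr_ge0 psi^`().[x]) => q q0.
have hs := psi_gt0 ax xb.
by apply: addr_ge0; rewrite !mulr_ge0 ?subr_ge0 // ltW.
Qed.

Lemma psi_neq0 : psi != 0.
Proof.
have := psi_gt0 (midf_lt ab).1 (midf_lt ab).2.
by apply: contraTneq => ->; rewrite horner0 ltxx.
Qed.

(** At a regular point the only exponents are [0] and [1]. *)
Lemma psi_left_simple g n : psi = g * ('X - a%:P) ^+ n -> ~~ root g a ->
  0 < A.[a] -> (n <= 1)%N.
Proof.
case: n => [|[|n]] // psig nga Aa.
have := @frobenius_exponent _ A (('X - a%:P) * B) (mu' *: (('X - a%:P) * L')) g a n.+1.
rewrite /= -psig -!mulrA -mulrDr psi_eq -scalerAr -scalerAl -mulrA => /(_ erefl nga).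
rewrite hornerM hornerXsubC subrr mul0r addr0 => /eqP.
by rewrite mulf_eq0 pnatr_eq0 (gt_eqF Aa).
Qed.

(** At a singular end point the nonzero exponent [1 - B/A'] is less than [1], so a
    polynomial solution cannot vanish there. *)
Lemma psi_left_gt0 : A.[a] = 0 -> 0 < A^`().[a] -> 0 < B.[a] -> 0 < psi.[a].
Proof.
move=> Aa A'a Ba; rewrite lt_neqAle (horner_ge0_left_end ab) ?andbT; last first.
  by move=> x ax xb; rewrite ltW ?psi_gt0.
rewrite eq_sym -[_ == 0]/(root psi a).
have [n [g]] := multiplicity_XsubC psi a; rewrite psi_neq0 /= => ng.
case: n => [|n psig]; first by rewrite expr0 mulr1 => ->.
have /factor_theorem[A1 A1E] : root A a by apply/eqP.
have A1a : A^`().[a] = A1.[a] by rewrite A1E horner_deriv_mulXsubC.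
have := @frobenius_exponent _ A1 B (mu' *: L') g a n.
rewrite /= -psig [_ * A1]mulrC -A1E psi_eq scalerAl => /(_ erefl ng) e.
have := ltr_wpDl (mulr_ge0 (ler0n R n) (ltW A'a)) Ba.
by rewrite A1a e ltxx.
Qed.

Lemma scaled_wronskian_left_ge0 : phi.[a] = 0 -> 0 <= W.[a].
Proof.
move=> pa; have /factor_theorem[p1 p1E] : root phi a by apply/eqP.
rewrite scaled_wronskianE pa mul0r mulr0 subr0.
apply: mulr_ge0; first by apply/ltW/(lt_le_trans mu_gt0).
apply: mulr_ge0; last first.
  by apply: (horner_ge0_left_end ab) => x ax xb; rewrite ltW ?psi_gt0.
rewrite p1E horner_deriv_mulXsubC.
apply: (horner_ge0_left_end ab) => x ax xb.
have := phi_gt0 ax xb; rewrite p1E hornerM hornerXsubC => h.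
by rewrite -(pmulr_lge0 _ (_ : 0 < x - a)) ?subr_gt0 // ltW.
Qed.

(** [W] becomes positive immediately after the left end point and after each of its
    own zeros.  The cases differ only in the factor that has to be split off
    from the operator of [picone_identity] to expose the leading order at [t]. *)
Lemma scaled_wronskian_gt0_right_of t d : W != 0 ->
    a <= t -> t < d -> d <= b ->
    (forall x, t < x -> x < d -> ~~ root W x) ->
    t = a /\ left_end A B phi a \/ a < t /\ root W t ->
  forall x, t < x -> x < d -> 0 < W.[x].
Proof.
move=> W0 at_ td db nr end_t.
have tb := lt_le_trans td db.
have mu'0 : 0 < mu' := lt_le_trans mu_gt0 mu_le.
have ineq x : t < x -> x < d ->
    0 <= A.[x] * (mu' * psi.[x]) * W^`().[x] + D.[x] * W.[x].
  by move=> tx xd; apply: picone_ge0; [apply: le_lt_trans tx | apply: lt_le_trans db].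
have psit_ge0 : 0 <= psi.[t].
  apply: (horner_ge0_left_end tb) => x tx xb; rewrite ltW // psi_gt0 //.
  exact: le_lt_trans tx.
have [sing|[At Wt]] : [/\ A.[t] = 0, 0 < A^`().[t] & t = a /\ 0 < B.[t]]
                      \/ 0 < A.[t] /\ 0 <= W.[t].
- case: end_t => [[-> [[? ? ?]|[Aa pa]]]|[lat /rootP ->]]; first by left.
    by right; split=> //; exact: scaled_wronskian_left_ge0.
  by right; rewrite A_gt0.
(* A singular end point: the zero of [A] is split off. *)
- case: sing => At A't [ta Bt].
  have psit : 0 < psi.[t] by move: At A't Bt; rewrite ta => *; exact: psi_left_gt0.
  have /factor_theorem[A1 A1E] : root A t by apply/eqP.
  have A1t : A^`().[t] = A1.[t] by rewrite A1E horner_deriv_mulXsubC.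
  apply: (@gt0_right_of_end _ (mu' *: (A1 * psi)) D W t d) => //.
    move=> x tx xd; have := ineq x tx xd.
    by rewrite A1E !(hornerXsubC, hornerM, hornerZ); congr (_ <= _); ring.
  move=> m g _ _; rewrite picone_coefE At hornerZ hornerM -A1t.
  have -> : mu' * (A^`().[t] * psi.[t]) * m%:R +
    (mu' * (B.[t] * psi.[t]) - (mu' - mu) * (0 * psi^`().[t]))
    = mu' * psi.[t] * (A^`().[t] * m%:R + B.[t]) by ring.
  by rewrite !pmulr_rgt0 // ltr_wpDl // mulr_ge0 // ltW.
have [Wt0|Wt0] := eqVneq W.[t] 0; last first.
  have {}Wt : 0 < W.[t] by rewrite lt_neqAle eq_sym Wt0.
  move=> x tx xd; rewrite ltNge le_eqVlt; apply/negP => /orP[Wx|Wx].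
    by have := nr x tx xd; rewrite rootE Wx.
  have [|y] := @poly_ivtoo _ W t x (ltW tx); first by rewrite pmulr_rlt0.
  rewrite in_itv /= => /andP[ty yx]; apply/negP/nr => //.
  exact: lt_trans yx xd.
have mpos m g : W = g * ('X - t%:P) ^+ m -> ~~ root g t -> 0 < m%:R :> R.
  case: m => [|m _ _]; last by rewrite ltr0n.
  by rewrite expr0 mulr1 => <-; rewrite rootE Wt0 eqxx.
(* A regular point at which [W] vanishes but [psi] does not: the whole inequality
   is multiplied by [x - t], and [W] has positive order. *)
have [psit|psit] := eqVneq psi.[t] 0; last first.
  apply: (@gt0_right_of_end _ (mu' *: (A * psi)) (('X - t%:P) * D) W t d) => //.
    move=> x tx xd; have := mulr_ge0 (_ : 0 <= x - t) (ineq x tx xd).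
    rewrite subr_ge0 (ltW tx) => /(_ isT).
    by rewrite !(hornerXsubC, hornerM, hornerZ); congr (_ <= _); ring.
  move=> m g Wg ng; rewrite hornerM hornerXsubC subrr mul0r addr0 hornerZ hornerM.
  by rewrite !mulr_gt0 ?(mpos _ _ Wg ng) // lt_neqAle eq_sym psit.
(* A common zero of [phi] and [psi]: the simple zero of [psi] is split off, and the
   order [m >= 1] of [W] outweighs the coefficient [-(mu' - mu) / mu']. *)
have ta : t = a.
  case: end_t => [[]//|[lat _]]; have := psi_gt0 lat tb.
  by rewrite psit ltxx.
have [n [g]] := multiplicity_XsubC psi t; rewrite psi_neq0 /= => ng psig.
have : (n <= 1)%N by move: psig ng At; rewrite ta; exact: psi_left_simple.
case: n psig => [|[|//]].
  by rewrite expr0 mulr1 => psig; move: ng; rewrite -psig rootE psit eqxx.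
rewrite expr1 => psig _.
have gt_gt0 : 0 < g.[t].
  rewrite lt_neqAle eq_sym -[_ == 0]/(root g t) ng /=.
  apply: (horner_ge0_left_end tb) => x tx xb.
  have := psi_gt0 (le_lt_trans at_ tx) xb; rewrite psig hornerM hornerXsubC => h.
  by rewrite -(pmulr_lge0 _ (_ : 0 < x - t)) ?subr_gt0 // ltW.
have psi't : psi^`().[t] = g.[t] by rewrite psig horner_deriv_mulXsubC.
apply: (@gt0_right_of_end _ (mu' *: (A * g)) D W t d) => //.
  move=> x tx xd; have := ineq x tx xd.
  by rewrite psig !(hornerXsubC, hornerM, hornerZ); congr (_ <= _); ring.
move=> m h Wh nh; rewrite picone_coefE psit psi't hornerZ hornerM.
have -> : mu' * (A.[t] * g.[t]) * m%:R
    + (mu' * (B.[t] * 0) - (mu' - mu) * (A.[t] * g.[t]))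
  = A.[t] * g.[t] * (mu' * (m%:R - 1) + mu) by ring.
rewrite !mulr_gt0 // ltr_wpDl // mulr_ge0 ?(ltW mu'0) // subr_ge0.
by have := mpos _ _ Wh nh; rewrite ltr0n ler1n.
Qed.

End Picone.

(** * The Sturm-Picone comparison theorem and zero counting *)

Section SturmPicone.
Variable R : rcfType.
Implicit Types (p A B L phi psi : {poly R}) (mu a b x : R).

(** Reflection [x |-> -x] exchanges left and right end points, so that only left end
    points have to be analysed. *)
Definition reflect_poly p := p \Po - 'X.

Lemma horner_reflect p x : (reflect_poly p).[x] = p.[- x].
Proof. by rewrite horner_comp hornerN hornerX. Qed.

Lemma reflect_polyK : involutive reflect_poly.
Proof.
move=> p; rewrite /reflect_poly -comp_polyA raddfN /= comp_polyX opprK.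
exact: comp_polyXr.
Qed.

Lemma deriv_reflect p : (reflect_poly p)^`() = - reflect_poly p^`().
Proof. by rewrite deriv_comp derivN derivX mulrN1. Qed.

Lemma derivn2_reflect p : (reflect_poly p)^`(2) = reflect_poly p^`(2).
Proof.
by rewrite !(derivSn, derivn0) deriv_reflect derivN deriv_reflect opprK.
Qed.

Lemma sturm_eq_reflect A B L mu p : sturm_eq A B L mu p ->
  sturm_eq (reflect_poly A) (- reflect_poly B) (reflect_poly L) mu (reflect_poly p).
Proof.
rewrite /sturm_eq derivn2_reflect deriv_reflect mulrNN /reflect_poly.
by rewrite -!comp_polyM -comp_polyD => ->; rewrite comp_polyZ.
Qed.

Lemma left_end_reflect A B p b : right_end A B p b ->
  left_end (reflect_poly A) (- reflect_poly B) (reflect_poly p) (- b).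
Proof.
rewrite /right_end /left_end deriv_reflect !hornerN !horner_reflect opprK !oppr_gt0.
by case; [left | right].
Qed.

Lemma scaled_wronskian_reflect mu mu' phi psi :
  scaled_wronskian mu mu' (reflect_poly phi) (reflect_poly psi)
  = - reflect_poly (scaled_wronskian mu mu' phi psi).
Proof.
rewrite /scaled_wronskian !deriv_reflect mulNr mulrN /reflect_poly.
by rewrite comp_polyB !comp_polyZ !comp_polyM !scalerN opprK opprB addrC.
Qed.

(** Let [t] be the last zero of [W] before [b], or [a] if there is none.  Then [W] is
    positive between [t] and [b] by the analysis at [t], and negative there by the
    reflected analysis at [b]. *)
Lemma sturm_picone_pos A B L L' phi psi mu mu' a b :
    0 < mu -> mu <= mu' -> a < b ->
    (forall x, a < x -> x < b -> 0 < A.[x]) ->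
    (forall x, a < x -> x < b -> L'.[x] <= L.[x]) ->
    sturm_eq A B L mu phi -> sturm_eq A B L' mu' psi ->
    left_end A B phi a -> right_end A B phi b ->
    scaled_wronskian mu mu' phi psi != 0 ->
    (forall x, a < x -> x < b -> 0 < phi.[x]) ->
    (forall x, a < x -> x < b -> 0 < psi.[x]) ->
  False.
Proof.
move=> mu0 lemu ab A0 leL ephi epsi la rb W0 phi0 psi0.
set W := scaled_wronskian _ _ _ _ in W0.
have [t [at_ tb nr end_t]] : exists t, [/\ a <= t, t < b,
    forall x, t < x -> x < b -> ~~ root W x
  & t = a /\ left_end A B phi a \/ a < t /\ root W t].
  have := @prev_root_lt _ W a b ab W0.
  case: prev_rootP => [p0|y _ Wy|c _ ->]; first by rewrite p0 eqxx in W0.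
  - rewrite in_itv /= => /andP[ay yb] nr _; exists y.
    split; rewrite ?(ltW ay) //; first by move=> x yx xb; apply: nr; rewrite in_itv /= yx.
    by right; split=> //; apply/eqP.
  - rewrite min_l ?(ltW ab) // => nr _; exists a; split=> //; last by left.
    by move=> x yx xb; apply: nr; rewrite in_itv /= yx.
have [tm mb] := midf_lt tb; set m := (t + b) / 2 in tm mb.
have := scaled_wronskian_gt0_right_of mu0 lemu ab A0 leL phi0 psi0 ephi epsi
  W0 at_ tb (lexx b) nr end_t tm mb.
have oppin x : - b < x -> x < - a -> a < - x /\ - x < b by lra.
have ba : - b < - a by lra.
have mb' : - b < - m by lra.
have tm' : - m < - t by lra.
have ta' : - t <= - a by lra.
have bt' : - b < - t by lra.
have Wr := scaled_wronskian_reflect mu mu' phi psi; rewrite -/W in Wr.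
have := @scaled_wronskian_gt0_right_of _ (reflect_poly A) (- reflect_poly B)
  (reflect_poly L) (reflect_poly L') (reflect_poly phi) (reflect_poly psi)
  mu mu' (- b) (- a) mu0 lemu ba _ _ _ _ (sturm_eq_reflect ephi)
  (sturm_eq_reflect epsi) (- b) (- t) _ (lexx _) bt' ta' _
  (or_introl (conj erefl (left_end_reflect rb))) (- m) mb' tm'.
rewrite Wr hornerN horner_reflect opprK => h1 h2.
have : 0 < - W.[m].
  apply: h1.
  - by move=> x /oppin h /h[? ?]; rewrite horner_reflect A0.
  - by move=> x /oppin h /h[? ?]; rewrite !horner_reflect leL.
  - by move=> x /oppin h /h[? ?]; rewrite horner_reflect phi0.
  - by move=> x /oppin h /h[? ?]; rewrite horner_reflect psi0.
  - rewrite oppr_eq0; apply: contraNneq W0 => Wr0.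
    by rewrite -[W]reflect_polyK Wr0 /reflect_poly comp_poly0.
  - move=> x bx xt; rewrite rootN rootE horner_reflect -/(root W (- x)).
    by apply: nr; lra.
by rewrite oppr_gt0 ltNge ltW.
Qed.

Lemma same_sign p a b m x : (forall y, a < y -> y < b -> ~~ root p y) ->
  a < m -> m < b -> a < x -> x < b -> 0 < p.[m] * p.[x].
Proof.
move=> nr.
have aux u v : a < u -> u <= v -> v < b -> 0 < p.[u] * p.[v].
  move=> au uv vb; rewrite ltNge le_eqVlt mulf_eq0; apply/negP => /orP[/orP[h|h]|h].
  - by have := nr u au (le_lt_trans uv vb); rewrite rootE h.
  - by have := nr v (lt_le_trans au uv) vb; rewrite rootE h.
  - have [y] := poly_ivtoo uv h; rewrite in_itv /= => /andP[uy yv]; apply/negP/nr.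
      exact: lt_trans uy.
    exact: lt_trans vb.
move=> am mb ax xb; have [mx|/ltW xm] := leP m x; first exact: aux.
by rewrite mulrC; apply: aux.
Qed.

Lemma sturm_eqZ A B L mu c p : sturm_eq A B L mu p -> sturm_eq A B L mu (c *: p).
Proof.
rewrite /sturm_eq derivnZ derivZ -!scalerAr -scalerDr => ->.
by rewrite scalerA mulrC -scalerA.
Qed.

Lemma left_endZ A B c p a : left_end A B p a -> left_end A B (c *: p) a.
Proof. by case=> [h|[? e]]; [left | right; rewrite hornerZ e mulr0]. Qed.

Lemma right_endZ A B c p a : right_end A B p a -> right_end A B (c *: p) a.
Proof. by case=> [h|[? e]]; [left | right; rewrite hornerZ e mulr0]. Qed.

(** The Sturm-Picone comparison theorem.  After [b] is moved back to the first zero of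
    [phi], a solution [psi] without zeros could be rescaled, like [phi], to be
    positive, and the strictness hypothesis keeps [W] from vanishing identically. *)
Lemma sturm_picone A B L L' phi psi mu mu' a b :
    0 < mu -> mu <= mu' -> a < b ->
    (forall x, a < x -> x < b -> 0 < A.[x]) ->
    (forall x, a < x -> x < b -> L'.[x] <= L.[x]) ->
    sturm_eq A B L mu phi -> sturm_eq A B L' mu' psi ->
    phi != 0 -> left_end A B phi a -> right_end A B phi b ->
    (forall x, a < x -> x < b -> L'.[x] < L.[x]) \/ mu < mu' /\ psi^`() != 0 ->
  exists x, [/\ a < x, x < b & root psi x].
Proof.
move=> mu0 lemu; wlog nr : b / forall x, a < x -> x < b -> ~~ root phi x.
  move=> wl ab A0 leL ephi epsi phi0 la rb strict.
  have [/next_root_gt -/(_ phi phi0) gta [leb Hb]] : a < b /\ next_root phi a b <= b /\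
     (next_root phi a b = b \/ next_root phi a b < b /\ phi.[next_root phi a b] = 0).
    split=> //; case: next_rootP => [p0|y _ py|c _ ->]; first by rewrite p0 eqxx in phi0.
      by rewrite in_itv /= => /andP[_ yb] _; rewrite ltW //; split=> //; right.
    by rewrite max_l ?(ltW ab) // lexx; split=> //; left.
  set c := next_root phi a b in gta leb Hb.
  have inb x : x < c -> x < b by move=> xc; apply: lt_le_trans leb.
  have [|||||x [ax xc rx]] := wl c _ gta _ _ ephi epsi phi0 la.
  - by move=> x ax xc; apply: (@next_noroot _ phi a b); rewrite in_itv /= ax.
  - by move=> x ax /inb; apply: A0.
  - by move=> x ax /inb; apply: leL.
  - case: Hb => [->//|[cb pc]]; right; split=> //; exact: A0.
  - by case: strict => [s|s]; [left=> x ax /inb; apply: s | right].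
  - by exists x; split=> //; apply: inb.
move=> ab A0 leL ephi epsi phi0 la rb strict.
have [am mb] := midf_lt ab; set m := (a + b) / 2 in am mb.
have [->|psi0] := eqVneq psi 0; first by exists m; rewrite root0.
case: (next_rootP psi a b) => [p0|y _ py yab _|c _ _ nrpsi].
- by rewrite p0 eqxx in psi0.
- by exists y; move: yab; rewrite in_itv /= => /andP[? ?]; split=> //; apply/rootP.
have {}nrpsi x : a < x -> x < b -> ~~ root psi x.
  by move=> ax xb; apply: nrpsi; rewrite in_itv /= ax.
exfalso.
have phim : phi.[m] != 0 by exact: nr.
have psim : psi.[m] != 0 by exact: nrpsi.
have phi_pos x : a < x -> x < b -> 0 < (phi.[m] *: phi).[x].
  by move=> ax xb; rewrite hornerZ (same_sign nr).
have psi_pos x : a < x -> x < b -> 0 < (psi.[m] *: psi).[x].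
  by move=> ax xb; rewrite hornerZ (same_sign nrpsi).
have ephi' := sturm_eqZ phi.[m] ephi; have epsi' := sturm_eqZ psi.[m] epsi.
apply: (sturm_picone_pos mu0 lemu ab A0 leL ephi' epsi' (left_endZ _ la)
  (right_endZ _ rb) _ phi_pos psi_pos).
have mu'0 := lt_le_trans mu0 lemu.
apply/eqP => W0; case: strict => [ltL|[ltmu dpsi]].
  have := picone_identity ephi' epsi' m; rewrite W0 deriv0 !horner0 !mulr0 addr0.
  move/eqP; rewrite eq_sym gt_eqF // ltr_wpDr //.
    rewrite mulr_ge0 ?sqr_ge0 // !mulr_ge0 ?subr_ge0 ?(ltW mu0) ?(ltW (A0 _ _ _)) //.
    by rewrite ltW ?phi_pos.
  by rewrite !mulr_gt0 ?exprn_gt0 ?subr_gt0 ?ltL ?phi_pos ?psi_pos.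
have [x [ax xb nrx _]] := exists_nonroot dpsi ab.
have := picone_identity ephi' epsi' x; rewrite W0 deriv0 !horner0 !mulr0 addr0.
move/eqP; rewrite eq_sym gt_eqF // ltr_wpDl //.
  rewrite mulr_ge0 ?sqr_ge0 // !mulr_ge0 ?subr_ge0 ?leL ?(ltW mu0) ?(ltW mu'0) //.
  by rewrite ltW ?phi_pos.
apply: mulr_gt0; first by rewrite !mulr_gt0 ?subr_gt0 ?A0 ?phi_pos.
rewrite lt_neqAle sqr_ge0 andbT eq_sym expf_eq0 /=.
by rewrite derivZ hornerZ mulf_eq0 negb_or psim.
Qed.

(** The list is only a witness: [m] is a lower bound for the number of zeros, which
    is what degree counting needs. *)
Definition has_zeros p a b m :=
  exists s : seq R, [/\ size s = m, path <%R a s, all (< b) s & all (root p) s].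

(** The [m] zeros cut the interval into [m + 1] pieces, and [sturm_picone] applies to
    each of them. *)
Lemma has_zeros_step A B L L' phi psi mu mu' a b m :
    0 < mu -> mu <= mu' -> a < b ->
    (forall x, a < x -> x < b -> 0 < A.[x]) ->
    (forall x, a < x -> x < b -> L'.[x] <= L.[x]) ->
    sturm_eq A B L mu phi -> sturm_eq A B L' mu' psi ->
    phi != 0 -> left_end A B phi a -> right_end A B phi b ->
    (forall x, a < x -> x < b -> L'.[x] < L.[x]) \/ mu < mu' /\ psi^`() != 0 ->
  has_zeros phi a b m -> has_zeros psi a b m.+1.
Proof.
move=> mu0 lemu ab A0 leL ephi epsi phi0 la rb strict [s [<- {m}]].
elim: s a ab A0 leL la strict => [|x s IHs] a ab A0 leL la strict /=.
  have [y [ay yb ry]] := sturm_picone mu0 lemu ab A0 leL ephi epsi phi0 la rb strict.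
  by exists [:: y]; rewrite /= ay yb ry.
move=> /andP[ax xs] /andP[xb sb] /andP[rx rs].
have inb y : y < x -> y < b by move=> yx; apply: lt_trans xb.
have ina y : x < y -> a < y by apply: lt_trans.
have Ax : 0 < A.[x] by apply: A0.
have [||||y [ay yx ry]] := sturm_picone mu0 lemu ax _ _ ephi epsi phi0 la.
- by move=> y ay /inb; apply: A0.
- by move=> y ay /inb; apply: leL.
- by right; split=> //; apply/rootP.
- by case: strict => [h|h]; [left=> y ay /inb; apply: h | right].
have [|||| t [szt pt tb rt]] := IHs x xb _ _ _ _ xs sb rs.
- by move=> z /ina h; apply: A0.
- by move=> z /ina h; apply: leL.
- by right; split=> //; apply/rootP.
- by case: strict => [h|h]; [left=> z /ina az; apply: h | right].
exists (y :: t); rewrite /= szt ay ry (inb _ yx) tb rt !andbT; split=> //=.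
by apply: (path_le lt_trans yx pt).
Qed.

End SturmPicone.

(** * Orthogonal polynomials: real and simple roots *)

(** The recurrence of the orthogonal polynomials of a Jacobi matrix, evaluated at [y].
    As [F] is only a ring, [u] may also be the sequence of these polynomials, with
    ['X] for [y]. *)
Definition three_term (F : nzRingType) (E d g : nat -> F) (y : F) (u : nat -> F) :=
  E 0 * u 0.+1 = (y - d 0) * u 0 /\
  forall j, E j.+1 * u j.+2 = (y - d j.+1) * u j.+1 - g j * u j.

(** Multiplying the [j]-th equation by [w j] makes the recurrence symmetric, and the
    difference of the two equations telescopes. *)
Lemma christoffel_darboux (F : comNzRingType) (E d g w : nat -> F) x y u v m :
    three_term E d g x u -> three_term E d g y v ->
    (forall j, (j < m)%N -> w j.+1 * g j = w j * E j) ->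
  w m * E m * (u m.+1 * v m - u m * v m.+1)
    = (x - y) * \sum_(j < m.+1) w j * (u j * v j).
Proof.
move=> [u0 uS] [v0 vS]; elim: m => [|m IHm] wE.
  rewrite big_ord1 -[w 0 * _ * _]mulrA.
  have -> : E 0 * (u 1 * v 0 - u 0 * v 1) = E 0 * u 1 * v 0 - u 0 * (E 0 * v 1) by ring.
  by rewrite u0 v0; ring.
rewrite big_ord_recr /= [RHS]mulrDr -IHm => [|j jm]; last exact/wE/ltnW.
rewrite -(wE m (ltnSn m)).
have -> : w m.+1 * E m.+1 * (u m.+2 * v m.+1 - u m.+1 * v m.+2)
  = w m.+1 * (E m.+1 * u m.+2 * v m.+1 - u m.+1 * (E m.+1 * v m.+2)) by ring.
by rewrite uS vS; ring.
Qed.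

Section OrthogonalPolynomials.
Variable K : fieldType.
Implicit Types (E d g w u : nat -> K) (y : K).

Fixpoint orthpoly E d g j : {poly K} :=
  if j is i.+1 then
    (E i)^-1 *: (('X - (d i)%:P) * orthpoly E d g i
                 - (if i is h.+1 then g h *: orthpoly E d g h else 0))
  else 1.

Lemma orthpolySS E d g j : orthpoly E d g j.+2 =
  (E j.+1)^-1 *: (('X - (d j.+1)%:P) * orthpoly E d g j.+1 - g j *: orthpoly E d g j).
Proof. by []. Qed.

Variables E d g : nat -> K.
Hypothesis E_neq0 : forall j, E j != 0.
Let P := orthpoly E d g.

Lemma orthpoly_three_term :
  three_term (fun j => (E j)%:P) (fun j => (d j)%:P) (fun j => (g j)%:P) 'X P.
Proof.
have PS j : P j.+1 = (E j)^-1 *: (('X - (d j)%:P) * P j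
                 - (if j is h.+1 then g h *: P h else 0)) by [].
by split=> [|j]; rewrite PS mul_polyC scalerA mulfV // scale1r ?subr0 ?mul_polyC.
Qed.

Lemma orthpoly_horner_three_term y : three_term E d g y (fun j => (P j).[y]).
Proof.
have [P0 PS] := orthpoly_three_term; split=> [|j].
  by have := congr1 (fun p => p.[y]) P0; rewrite !(hornerXsubC, hornerM, hornerC).
have := congr1 (fun p => p.[y]) (PS j).
by rewrite !(hornerXsubC, hornerM, hornerD, hornerN, hornerC).
Qed.

Lemma three_term_orthpoly y u : three_term E d g y u ->
  forall j, u j = u 0 * (P j).[y].
Proof.
move=> [u0 uS]; have [p0 pS] := orthpoly_horner_three_term y; cbv beta in p0, pS.
suff H j : u j = u 0 * (P j).[y] /\ u j.+1 = u 0 * (P j.+1).[y] by move=> j; case: (H j).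
elim: j => [|j [IHj IHj1]].
  split; first by rewrite hornerC mulr1.
  by apply: (mulfI (E_neq0 0)); rewrite u0 mulrCA p0 hornerC; ring.
split=> //; apply: (mulfI (E_neq0 j.+1)); rewrite uS mulrCA pS IHj IHj1; ring.
Qed.

Lemma size_orthpoly j : size (P j) = j.+1.
Proof.
have szX c (p : {poly K}) n : size p = n.+1 -> size (('X - c%:P) * p) = n.+2.
  move=> szp; rewrite size_mul ?polyXsubC_eq0 ?size_XsubC ?szp //.
  by rewrite -size_poly_eq0 szp.
suff H : size (P j) = j.+1 /\ size (P j.+1) = j.+2 by case: H.
elim: j => [|j [IHj IHj1]].
  by rewrite /P /= size_poly1 subr0 size_scale ?invr_eq0 // (szX _ _ 0) ?size_poly1.
split=> //; rewrite /P orthpolySS size_scale ?invr_eq0 //.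
rewrite size_polyDl (szX _ _ j.+1) // size_polyN.
by apply: leq_ltn_trans (size_scale_leq _ _) _; rewrite IHj ltnS leqnSn.
Qed.

End OrthogonalPolynomials.

Lemma eq_orthpoly (K : fieldType) (E E' d d' g g' : nat -> K) :
  E =1 E' -> d =1 d' -> g =1 g' -> orthpoly E d g =1 orthpoly E' d' g'.
Proof.
move=> eE ed eg j.
suff H : orthpoly E d g j = orthpoly E' d' g' j
      /\ orthpoly E d g j.+1 = orthpoly E' d' g' j.+1 by case: H.
elim: j => [|j [IHj IHj1]]; first by rewrite /= eE ed.
by split=> //; rewrite !orthpolySS IHj IHj1 eE ed eg.
Qed.

Lemma map_orthpoly (K K' : fieldType) (f : {rmorphism K -> K'}) E d g j :
  map_poly f (orthpoly E d g j) = orthpoly (f \o E) (f \o d) (f \o g) j.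
Proof.
suff H : map_poly f (orthpoly E d g j) = orthpoly (f \o E) (f \o d) (f \o g) j
   /\ map_poly f (orthpoly E d g j.+1) = orthpoly (f \o E) (f \o d) (f \o g) j.+1.
  by case: H.
elim: j => [|j [IHj IHj1]].
  split; first exact: rmorph1.
  by rewrite /= !subr0 !mulr1 map_polyZ map_polyXsubC /= fmorphV.
split=> //; rewrite !orthpolySS -IHj -IHj1 map_polyZ fmorphV.
move: (orthpoly E d g j.+1) (orthpoly E d g j) => p q.
by rewrite rmorphB rmorphM /= map_polyXsubC map_polyZ.
Qed.

Section Roots.
Variables (C : numClosedFieldType) (E d g : nat -> C) (k : nat).
Hypothesis E_gt0 : forall j, 0 < E j.
Hypothesis d_real : forall j, d j \is Num.real.
Hypothesis g_real : forall j, g j \is Num.real.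
Hypothesis g_gt0 : forall j, (j < k)%N -> 0 < g j.

Let P := orthpoly E d g.

(** The weights that symmetrize the recurrence. *)
Fixpoint cd_weight j : C := if j is i.+1 then cd_weight i * E i / g i else 1.

Lemma cd_weightE j : (j < k)%N -> cd_weight j.+1 * g j = cd_weight j * E j.
Proof. by move=> jk; rewrite /= divfK // gt_eqF // g_gt0. Qed.

Lemma cd_weight_gt0 j : (j <= k)%N -> 0 < cd_weight j.
Proof. by elim: j => //= j IHj jk; rewrite divr_gt0 ?mulr_gt0 ?g_gt0 ?IHj // ltnW. Qed.

Lemma cd_sum_gt0 y :
  0 < \sum_(j < k.+1) cd_weight j * ((P j).[y] * ((P j).[y])^*).
Proof.
rewrite big_ord_recl /= hornerC rmorph1 !mulr1 ltr_wpDr //.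
apply: sumr_ge0 => j _; rewrite mulr_ge0 ?mul_conjC_ge0 // ltW //.
exact: (@cd_weight_gt0 (bump 0 j)).
Qed.

Lemma orthpoly_conj_three_term y : three_term E d g y^* (fun j => ((P j).[y])^*).
Proof.
have En j : E j != 0 by rewrite gt_eqF.
have [] := orthpoly_horner_three_term d g En y; rewrite -/P => u0 uS.
have Er j : (E j)^* = E j by apply/CrealP/gtr0_real.
have dr j : (d j)^* = d j by apply/CrealP.
have gr j : (g j)^* = g j by apply/CrealP.
split=> [|j]; first by have /(congr1 Num.conj) := u0; rewrite !rmorphM rmorphB /= Er dr.
by have /(congr1 Num.conj) := uS j; rewrite !(rmorphB, rmorphM) /= Er dr gr.
Qed.

(** Applied to [y] and its conjugate, at a root, the Christoffel-Darboux identity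
    leaves [(y - y^* )] times a positive sum. *)
Lemma orthpoly_root_real y : root (P k.+1) y -> y \is Num.real.
Proof.
move=> /rootP Py.
have En j : E j != 0 by rewrite gt_eqF.
have Eu := orthpoly_horner_three_term d g En y; rewrite -/P in Eu.
have Ev := orthpoly_conj_three_term y.
have := christoffel_darboux Eu Ev cd_weightE.
rewrite Py rmorph0 mul0r mulr0 subrr mulr0 => /esym/eqP.
rewrite mulf_eq0 (gt_eqF (cd_sum_gt0 y)) orbF subr_eq0 => /eqP yy.
by apply/CrealP.
Qed.

(** The confluent case: the Christoffel-Darboux identity between ['X] and the constant
    [y], divided by ['X - y] and evaluated at [y], equates the positive sum to a
    multiple of what a double root makes vanish. *)
Lemma orthpoly_root_simple y : ~~ (('X - y%:P) ^+ 2 %| P k.+1).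
Proof.
apply/negP => dv.
have /rootP Py : root (P k.+1) y.
  by rewrite -dvdp_XsubCl (dvdp_trans _ dv) // expr2 dvdp_mulr.
have yr : y \is Num.real by apply: orthpoly_root_real; apply/rootP.
have En j : E j != 0 by rewrite gt_eqF.
have Eu := orthpoly_three_term d g En.
have Ev : three_term (fun j => (E j)%:P) (fun j => (d j)%:P) (fun j => (g j)%:P)
    y%:P (fun j => ((P j).[y])%:P).
  have [v0 vS] := orthpoly_horner_three_term d g En y.
  split=> [|j]; first by rewrite -polyCM v0 polyCM polyCB.
  by rewrite -polyCM vS polyCB !polyCM polyCB.
have wE j : (j < k)%N ->
    (cd_weight j.+1)%:P * (g j)%:P = (cd_weight j)%:P * (E j)%:P.
  by move=> jk; rewrite -!polyCM cd_weightE.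
have := christoffel_darboux Eu Ev wE; rewrite -/P Py mulr0 subr0.
case/dvdpP: dv => q ->; rewrite expr2.
rewrite [X in X = _ -> _](_ : _ = ('X - y%:P) *
    ((cd_weight k)%:P * (E k)%:P * (q * ('X - y%:P) * ((P k).[y])%:P))); last first.
  by move: ('X - _) => Z; ring.
move/(mulfI (negbT (polyXsubC_eq0 _)))/(congr1 (fun p => p.[y])).
rewrite !(hornerXsubC, hornerM) subrr !(mulr0, mul0r) horner_sum.
have pr j : ((P j).[y])^* = (P j).[y].
  have := orthpoly_conj_three_term y; rewrite (CrealP yr) => /(three_term_orthpoly En) ->.
  by rewrite hornerC rmorph1 mul1r.
have := cd_sum_gt0 y => /[swap]; rewrite (_ : \sum_(j < _) _.[y] =
   \sum_(j < k.+1) cd_weight j * ((P j).[y] * ((P j).[y])^*)).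
  by move <-; rewrite ltxx.
by apply: eq_bigr => j _; rewrite !(hornerM, hornerC) pr.
Qed.

Lemma orthpoly_real_roots : exists s : seq C,
  [/\ size s = k.+1, uniq s, {in s, forall y, y \is Num.real}
    & forall y, root (P k.+1) y = (y \in s)].
Proof.
have En j : E j != 0 by rewrite gt_eqF.
have szP := size_orthpoly d g En k.+1; rewrite -/P in szP.
have [s Ps] := closed_field_poly_normal (P k.+1).
have lc0 : lead_coef (P k.+1) != 0 by rewrite lead_coef_eq0 -size_poly_eq0 szP.
have rootE y : root (P k.+1) y = (y \in s) by rewrite Ps rootZ // root_prod_XsubC.
exists s; split=> //.
- by move: szP; rewrite Ps size_scale // size_prod_XsubC => -[].
- have : forall y, ~~ (('X - y%:P) ^+ 2 %| \prod_(z <- s) ('X - z%:P)).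
    by move=> y; have := orthpoly_root_simple y; rewrite Ps dvdpZr.
  elim: (s) => //= y t IHt sq; rewrite IHt; last first.
    by move=> z; apply: contraNN (sq z) => h; rewrite big_cons dvdp_mull.
  rewrite andbT; apply: contraNN (sq y) => yt.
  by rewrite big_cons expr2 dvdp_mul2l ?polyXsubC_eq0 // dvdp_XsubCl root_prod_XsubC.
- by move=> y; rewrite -rootE; exact: orthpoly_root_real.
Qed.

End Roots.

(** * The Lame operator in powers of x minus the middle singular point *)

Definition mid3 : 'I_3 := @Ordinal 3 1 isT.

Section LameCoefficients.
Variables (F : comNzRingType) (alpha rho : 'I_3 -> F).
Implicit Types (mu nu : F) (phi : {poly F}).

Local Notation a0 := (alpha ord0).
Local Notation a1 := (alpha mid3).
Local Notation a2 := (alpha ord_max).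

Lemma lameAE : lameA alpha = ('X - a0%:P) * ('X - a1%:P) * ('X - a2%:P).
Proof.
rewrite /lameA !big_ord_recr big_ord0 /= mul1r.
by congr (('X - (alpha _)%:P) * ('X - (alpha _)%:P) * ('X - (alpha _)%:P));
  apply: val_inj.
Qed.

Lemma lameBE : lameB alpha rho =
    (2 * rho ord0)%:P * (('X - a1%:P) * ('X - a2%:P))
  + (2 * rho mid3)%:P * (('X - a0%:P) * ('X - a2%:P))
  + (2 * rho ord_max)%:P * (('X - a0%:P) * ('X - a1%:P)).
Proof.
have e0 : widen_ord (leqnSn 2) (widen_ord (leqnSn 1) ord_max) = ord0 by apply: val_inj.
have e1 : widen_ord (leqnSn 2) ord_max = mid3 by apply: val_inj.
rewrite /lameB !big_ord_recr big_ord0 /= add0r e0 e1.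
by congr (_ * _ + _ * _ + _ * _);
  rewrite big_mkcond !big_ord_recr big_ord0 /= ?e0 ?e1 ?mul1r ?mulr1.
Qed.

Definition rho_sum := 2 * (rho ord0 + rho mid3 + rho ord_max).
(** [lame_mu k] is the value of [mu] forced by a solution of degree [k].  Together with
    [lame_up] and [lame_diag] it describes the action of the differential operator on
    the powers of [x - alpha_2], for the middle singular point [alpha_2]. *)
Definition lame_mu k := k%:R * (k%:R - 1 + rho_sum).
Definition lame_up j :=
  - ((a0 - a1) * (a2 - a1)) * (j.+1%:R * (j%:R + 2 * rho mid3)).
Definition lame_diag j :=
  j%:R * ((a0 - a1 + (a2 - a1)) * (j%:R - 1) + 2 * rho ord0 * (a2 - a1)
          + 2 * rho mid3 * (a0 - a1 + (a2 - a1)) + 2 * rho ord_max * (a0 - a1)).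

Lemma comp_XaddC_inj (c : F) : injective (fun p : {poly F} => p \Po ('X + c%:P)).
Proof.
apply: (can_inj (g := fun p => p \Po ('X - c%:P))) => p.
by rewrite -comp_polyA comp_polyD comp_polyX comp_polyC addrNK comp_polyXr.
Qed.

(** Expanding at the middle singular point removes the constant term of [A], which
    makes the operator tridiagonal; it also makes [(a0 - a1) * (a2 - a1)] negative,
    which gives the recurrence the signs of a Jacobi matrix. *)
Lemma lame_equation_three_term mu nu phi :
  lame_equation alpha rho mu nu phi <->
  three_term lame_up lame_diag (fun j => mu - lame_mu j) (mu * (nu - a1))
    (fun j => (phi \Po ('X + a1%:P))`_j).
Proof.
set q := phi \Po _.
have dq : q^`() = phi^`() \Po ('X + a1%:P).
  by rewrite deriv_comp derivD derivX derivC addr0 mulr1.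
have d2q : q^`(2) = phi^`(2) \Po ('X + a1%:P).
  by rewrite !(derivSn, derivn0) dq deriv_comp derivD derivX derivC addr0 mulr1.
pose a := a0 - a1; pose b := a2 - a1.
pose beta := 2 * rho ord0 * b + 2 * rho mid3 * (a + b) + 2 * rho ord_max * a.
(* The two sides of the equation, written so that each term is a power of ['X] times a
   derivative of [q]. *)
pose lhs := 'X * ('X * ('X * q^`(2))) - (a + b) *: ('X * ('X * q^`(2)))
   + (a * b) *: ('X * q^`(2)) + rho_sum *: ('X * ('X * q^`())) - beta *: ('X * q^`())
   + (2 * rho mid3 * (a * b)) *: q^`().
pose rhs := mu *: ('X * q) - (mu * (nu - a1)) *: q.
have lameE : lame_equation alpha rho mu nu phi <-> lhs = rhs.
  have -> : lhs = (lameA alpha * phi^`(2) + lameB alpha rho * phi^`()) \Po ('X + a1%:P).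
    rewrite comp_polyD !comp_polyM -d2q -dq lameAE lameBE.
    rewrite !(comp_polyB, comp_polyD, comp_polyM, comp_polyX, comp_polyC).
    rewrite /lhs /rho_sum /beta /a /b -!mul_polyC !(polyCM, polyCD, polyCN).
    move: 'X (q^`(2)) (q^`()) => X q2 q1.
    by move: (polyC a0) (polyC a1) (polyC a2) => c0 c1 c2; ring.
  have -> : rhs = (mu *: (('X - nu%:P) * phi)) \Po ('X + a1%:P).
    rewrite comp_polyZ comp_polyM comp_polyB comp_polyX comp_polyC -/q /rhs.
    rewrite -!mul_polyC !(polyCM, polyCB); move: 'X (q) => X p.
    by ring.
  by split=> [->|/comp_XaddC_inj].
have q2E j : (q^`(2))`_j = q`_j.+2 * (j.+2%:R * j.+1%:R).
  by rewrite !(derivSn, derivn0) !coef_deriv -mulrnA -natrM mulr_natr mulnC.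
have q1E j : (q^`())`_j = q`_j.+1 * j.+1%:R by rewrite coef_deriv mulr_natr.
have lhs0 : (lhs)`_0 = - (lame_up 0 * q`_1).
  rewrite /lhs !(coefD, coefB, coefN, coefZ, coefXM) /= q1E /lame_up -/a -/b.
  by ring.
have lhsS j : (lhs)`_j.+1 = lame_mu j * q`_j - lame_diag j.+1 * q`_j.+1
    - lame_up j.+1 * q`_j.+2.
  rewrite /lhs !(coefD, coefB, coefN, coefZ, coefXM) /=.
  rewrite /lame_mu /lame_up /lame_diag -/a -/b.
  case: j => [|[|j]] /=; rewrite ?q2E ?q1E /=.
  - rewrite /beta; ring.
  - rewrite /beta; ring.
  - rewrite /beta -[j.+4]addn4 -[j.+3]addn3 -[j.+2]addn2 -[j.+1]addn1 !natrD; ring.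
rewrite lameE; split=> [e|[e0 eS]].
  split=> [|j].
    have := congr1 (fun p : {poly F} => p`_0) e.
    rewrite /= lhs0 /rhs !(coefB, coefZ, coefXM) /= mulr0 sub0r => /oppr_inj ->.
    by rewrite /lame_diag !mul0r subr0.
  have := congr1 (fun p : {poly F} => p`_j.+1) e.
  rewrite /= lhsS /rhs !(coefB, coefZ, coefXM) /= => ej.
  apply/eqP; rewrite -subr_eq0; apply/eqP; move/eqP: ej; rewrite -subr_eq0 => /eqP ej.
  by rewrite -[RHS]oppr0 -[in RHS]ej; ring.
apply/polyP => -[|j].
  rewrite lhs0 e0 /rhs !(coefB, coefZ, coefXM) /= /lame_diag; ring.
rewrite lhsS eS /rhs !(coefB, coefZ, coefXM) /=; ring.
Qed.

End LameCoefficients.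

(** * Van Vleck zeros as roots of the spectral polynomial *)

(** Up to a constant, the characteristic polynomial of the Jacobi matrix, in the variable
    [mu * (nu - alpha_2)] with [alpha_2] the middle singular point.  The coefficient [g]
    vanishes at [k], which is why the recurrence can stop there. *)
Definition spectral_poly (K : fieldType) (alpha rho : 'I_3 -> K) k :=
  orthpoly (lame_up alpha rho) (lame_diag alpha rho)
           (fun j => lame_mu rho k - lame_mu rho j) k.+1.

Section Spectral.
Variables (K : numFieldType) (alpha rho : 'I_3 -> K).
Hypothesis alpha_incr : forall i j : 'I_3, (i < j)%N -> alpha i < alpha j.
Hypothesis rho_gt0 : forall j : 'I_3, 0 < rho j.

Lemma lame_up_gt0 j : 0 < lame_up alpha rho j.
Proof.
rewrite /lame_up mulr_gt0 //.
  by rewrite -mulNr opprB mulr_gt0 // subr_gt0 alpha_incr.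
by rewrite mulr_gt0 ?ltr0n // ltr_wpDl ?ler0n // mulr_gt0 ?ltr0n.
Qed.

Lemma rho_sum_gt0 : 0 < rho_sum rho.
Proof. by rewrite /rho_sum mulr_gt0 ?ltr0n // !addr_gt0. Qed.

Lemma lame_mu_lt j k : (j < k)%N -> lame_mu rho j < lame_mu rho k.
Proof.
move=> jk; rewrite -subr_gt0 -(subnK jk); set m := (k - j.+1)%N.
have -> : lame_mu rho (m + j.+1) - lame_mu rho j
  = m.+1%:R * (j%:R + (m + j)%:R + rho_sum rho).
  rewrite /lame_mu addnS -[(m + j).+1]addn1 -[m.+1]addn1 !natrD.
  by ring.
by rewrite mulr_gt0 ?ltr0n // ltr_wpDl ?rho_sum_gt0 // -natrD ler0n.
Qed.

Lemma lame_mu_gt0 k : (0 < k)%N -> 0 < lame_mu rho k.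
Proof. by move/lame_mu_lt; rewrite /lame_mu mul0r. Qed.

Lemma size_comp_XaddC (c : K) (p : {poly K}) : size (p \Po ('X + c%:P)) = size p.
Proof. by rewrite size_comp_poly2 // size_XaddC. Qed.

Lemma lame_equation_mu mu nu (phi : {poly K}) k : size phi = k.+1 ->
  lame_equation alpha rho mu nu phi -> mu = lame_mu rho k.
Proof.
move=> szp /lame_equation_three_term[_ /(_ k)].
set q := phi \Po _; have szq : size q = k.+1 by rewrite size_comp_XaddC.
rewrite [q`_k.+2]nth_default ?szq // [q`_k.+1]nth_default ?szq // !mulr0 sub0r.
move/esym/eqP; rewrite oppr_eq0 mulf_eq0 subr_eq0 => /orP[/eqP//|].
by rewrite -[k]/(k.+1.-1) -szq -/(lead_coef q) lead_coef_eq0 -size_poly_eq0 szq.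
Qed.

(** A polynomial of degree [k] is a sequence of coefficients that stops after the
    [k]-th; as [g k = 0], the recurrence stops as soon as the next value is zero. *)
Lemma van_vleck_zero_root k z : (0 < k)%N ->
  van_vleck_zero alpha rho k z <->
  root (spectral_poly alpha rho k) (lame_mu rho k * (z - alpha mid3)).
Proof.
move=> k0; set y := lame_mu rho k * _.
have En j : lame_up alpha rho j != 0 by rewrite gt_eqF // lame_up_gt0.
set d := lame_diag alpha rho; set g := fun j => lame_mu rho k - lame_mu rho j.
have gn j : (j < k)%N -> g j != 0 by move=> jk; rewrite gt_eqF // subr_gt0 lame_mu_lt.
split.
  move=> [mu [phi [szp eqp]]]; have mu_k := lame_equation_mu szp eqp.
  have szq := size_comp_XaddC (alpha mid3) phi; rewrite szp in szq.
  move: eqp; rewrite mu_k => /lame_equation_three_term.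
  set q := phi \Po _ in szq *; move/(three_term_orthpoly En) => uE.
  have q0 : q`_0 != 0.
    apply: contra_eq_neq szq => q0; suff -> : q = 0 by rewrite size_poly0.
    by apply/polyP => j; rewrite uE q0 mul0r coef0.
  apply/rootP/(mulfI q0); rewrite mulr0 -uE.
  by rewrite nth_default ?szq.
move=> /rootP Py.
pose P := orthpoly (lame_up alpha rho) d g.
have [P0 PS] : three_term (lame_up alpha rho) d g y (fun j => (P j).[y]).
  exact: orthpoly_horner_three_term.
have Pk1 : (P k.+1).[y] = 0 by [].
(* Run backwards, the recurrence would propagate a zero down to [P 0 = 1]. *)
have Pk : (P k).[y] != 0.
  apply/eqP => Pk; suff H j : (j <= k)%N -> (P j).[y] = 0 /\ (P j.+1).[y] = 0 -> False.
    exact: (H k).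
  elim: j => [_ [/eqP]|j IHj jk [P1 P2]]; first by rewrite hornerC oner_eq0.
  apply: IHj; first exact: ltnW.
  split=> //; apply/(mulfI (gn _ jk)); have := PS j; rewrite P1 P2 !mulr0 sub0r.
  by move/esym/eqP; rewrite oppr_eq0 => /eqP.
pose q := \poly_(j < k.+1) (P j).[y].
have qE j : q`_j = if (j < k.+1)%N then (P j).[y] else 0 by rewrite coef_poly.
have szq : size q = k.+1 by rewrite size_poly_eq.
exists (lame_mu rho k), (q \Po ('X - (alpha mid3)%:P)).
split; first by rewrite -polyCN size_comp_XaddC.
apply/lame_equation_three_term; rewrite -/y -/d -/g.
have -> : (q \Po ('X - (alpha mid3)%:P)) \Po ('X + (alpha mid3)%:P) = q.
  by rewrite -comp_polyA comp_polyB comp_polyX comp_polyC addrK comp_polyXr.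
split=> [|j]; first by rewrite !qE /= ltnS k0.
rewrite !qE !ltnS; have [jk|kj] := ltnP j k.
  rewrite (ltnW jk) -PS; have [//|kj] := ltnP j.+1 k.
  have jk1 : j.+1 = k by apply/eqP; rewrite eqn_leq jk kj.
  by rewrite [in RHS]jk1 Pk1 !mulr0.
rewrite ltnNge (leq_trans kj) //= !mulr0 sub0r.
have [jk|] := leqP j k; last by rewrite mulr0 oppr0.
have -> : j = k by apply/eqP; rewrite eqn_leq jk kj.
by rewrite /g subrr mul0r oppr0.
Qed.

End Spectral.

Section Morphism.
Variables (K K' : fieldType) (f : {rmorphism K -> K'}) (alpha rho : 'I_3 -> K).

Lemma rmorph_lame_up j :
  f (lame_up alpha rho j) = lame_up (fun i => f (alpha i)) (fun i => f (rho i)) j.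
Proof. by rewrite /lame_up !(rmorphM, rmorphD, rmorphN, rmorph1, rmorph_nat). Qed.

Lemma rmorph_lame_diag j :
  f (lame_diag alpha rho j) = lame_diag (fun i => f (alpha i)) (fun i => f (rho i)) j.
Proof. by rewrite /lame_diag !(rmorphM, rmorphD, rmorphN, rmorph1, rmorph_nat). Qed.

Lemma rmorph_lame_mu j : f (lame_mu rho j) = lame_mu (fun i => f (rho i)) j.
Proof.
by rewrite /lame_mu /rho_sum !(rmorphM, rmorphD, rmorphN, rmorph1, rmorph_nat).
Qed.

Lemma map_spectral_poly k :
  map_poly f (spectral_poly alpha rho k)
    = spectral_poly (fun j => f (alpha j)) (fun j => f (rho j)) k.
Proof.
rewrite /spectral_poly map_orthpoly; apply: eq_orthpoly => j /=.
- exact: rmorph_lame_up.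
- exact: rmorph_lame_diag.
- by rewrite rmorphB !rmorph_lame_mu.
Qed.

End Morphism.

Section Enumeration.
Variables (R : realType) (alpha rho : 'I_3 -> R).
Hypothesis alpha_incr : forall i j : 'I_3, (i < j)%N -> alpha i < alpha j.
Hypothesis rho_gt0 : forall j : 'I_3, 0 < rho j.

Local Notation toC := (real_complex R).
Local Notation alphaC := (fun j : 'I_3 => toC (alpha j)).
Local Notation rhoC := (fun j : 'I_3 => toC (rho j)).

Lemma alphaC_incr (i j : 'I_3) : (i < j)%N -> toC (alpha i) < toC (alpha j).
Proof. by move=> /alpha_incr; rewrite ltcR. Qed.

Lemma rhoC_gt0 j : 0 < toC (rho j).
Proof. by rewrite ltcR. Qed.

Lemma van_vleck_zero_real k x : (0 < k)%N ->
  van_vleck_zero alphaC rhoC k (toC x) -> van_vleck_zero alpha rho k x.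
Proof.
move=> k0 /(van_vleck_zero_root alphaC_incr rhoC_gt0 _ k0).
rewrite -map_spectral_poly -rmorph_lame_mu -rmorphB -rmorphM fmorph_root => h.
exact/(van_vleck_zero_root alpha_incr rho_gt0 _ k0).
Qed.

(** The Van Vleck zeros are the images of the [k + 1] simple real roots of the spectral
    polynomial under an injective affine map. *)
Lemma van_vleck_enum_exists k : (0 < k)%N ->
  exists nu : 'I_k.+1 -> R, van_vleck_enum alpha rho nu.
Proof.
move=> k0; have mu0 := lame_mu_gt0 rhoC_gt0 k0.
have mu_neq0 : lame_mu rhoC k != 0 by rewrite gt_eqF.
have dr j : lame_diag alphaC rhoC j \is Num.real.
  by rewrite -rmorph_lame_diag; apply/complex_realP; eexists.
have gr j : lame_mu rhoC k - lame_mu rhoC j \is Num.real.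
  by rewrite -!rmorph_lame_mu -rmorphB; apply/complex_realP; eexists.
have gg j : (j < k)%N -> 0 < lame_mu rhoC k - lame_mu rhoC j.
  by move=> jk; rewrite subr_gt0 lame_mu_lt //; exact: rhoC_gt0.
have [s [szs us reals rootE]] := orthpoly_real_roots
  (lame_up_gt0 alphaC_incr rhoC_gt0) dr gr gg.
pose f (y : R[i]) := complex.Re (y / lame_mu rhoC k + toC (alpha mid3)).
have fE y : y \in s -> toC (f y) = y / lame_mu rhoC k + toC (alpha mid3).
  move=> /reals yr; apply: RRe_real.
  rewrite realD ?realM ?realV ?(gtr0_real mu0) //.
  by apply/complex_realP; eexists.
have f_inj : {in s &, injective f}.
  move=> y y' ys ys' e; have := fE _ ys; rewrite e (fE _ ys') => /addIr/esym.
  by apply/mulIf; rewrite invr_eq0.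
pose t := sort <=%R (map f s).
have szt : size t = k.+1 by rewrite size_sort size_map.
have t_lt : sorted <%R t.
  by rewrite sort_lt_sorted map_inj_in_uniq.
exists (fun i => t`_i); split=> [i j ij|z].
  by rewrite (sorted_ltn_nth lt_trans 0 t_lt) // inE szt.
rewrite (van_vleck_zero_root alphaC_incr rhoC_gt0 _ k0).
rewrite rootE; split=> [zs|[i ->]].
  have : z = toC (f (lame_mu rhoC k * (z - toC (alpha mid3)))).
    by rewrite fE // mulrC mulKf // addrNK.
  set x := f _ => zx; have xt : x \in t by rewrite mem_sort map_f.
  have it : (index x t < k.+1)%N by rewrite -szt index_mem.
  by exists (Ordinal it); rewrite /= nth_index.
have : t`_i \in t by rewrite mem_nth ?szt.
rewrite mem_sort => /mapP[y ys ->].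
by rewrite fE // addrK mulrC divfK.
Qed.

End Enumeration.

(** * Zeros of the solutions and interlacing *)

Section Interlacing.
Variables (R : realType) (alpha rho : 'I_3 -> R).
Hypothesis alpha_incr : forall i j : 'I_3, (i < j)%N -> alpha i < alpha j.
Hypothesis rho_gt0 : forall j : 'I_3, 0 < rho j.

Local Notation a0 := (alpha ord0).
Local Notation a1 := (alpha mid3).
Local Notation a2 := (alpha ord_max).
Local Notation A := (lameA alpha).
Local Notation B := (lameB alpha rho).

Lemma alpha01 : a0 < a1. Proof. exact: alpha_incr. Qed.
Lemma alpha12 : a1 < a2. Proof. exact: alpha_incr. Qed.
Lemma alpha02 : a0 < a2. Proof. exact: alpha_incr. Qed.

Lemma horner_lameA x : A.[x] = (x - a0) * (x - a1) * (x - a2).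
Proof. by rewrite lameAE !hornerM !hornerXsubC. Qed.

Lemma horner_deriv_lameA x : A^`().[x] =
  (x - a1) * (x - a2) + (x - a0) * (x - a2) + (x - a0) * (x - a1).
Proof.
rewrite lameAE !derivM !derivXsubC !(mul1r, mulr1).
by rewrite !(hornerXsubC, hornerD, hornerM); ring.
Qed.

Lemma horner_lameB x : B.[x] = 2 * rho ord0 * ((x - a1) * (x - a2))
  + 2 * rho mid3 * ((x - a0) * (x - a2)) + 2 * rho ord_max * ((x - a0) * (x - a1)).
Proof. by rewrite lameBE !hornerD !hornerM !hornerC !hornerXsubC. Qed.

Lemma lameA_gt0 x : a0 < x -> x < a1 -> 0 < A.[x].
Proof.
move=> h0 h1; rewrite horner_lameA -mulrA pmulr_rgt0 ?subr_gt0 //.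
by rewrite nmulr_rgt0 ?subr_lt0 // (lt_trans h1) // alpha12.
Qed.

Lemma oppr_lameA_gt0 x : a1 < x -> x < a2 -> 0 < (- A).[x].
Proof.
move=> h1 h2; rewrite hornerN horner_lameA -mulrN opprB !mulr_gt0 ?subr_gt0 //.
exact: lt_trans alpha01 _.
Qed.

Lemma left_end_lame p : left_end A B p a0.
Proof.
left; have h : 0 < (a0 - a1) * (a0 - a2).
  by rewrite nmulr_rgt0 subr_lt0 ?alpha01 ?alpha02.
rewrite horner_lameA horner_deriv_lameA horner_lameB subrr !(mul0r, mulr0, add0r, addr0).
by split=> //; apply: mulr_gt0 => //; apply: mulr_gt0.
Qed.

Lemma lame_mid_lt0 : (a1 - a0) * (a1 - a2) < 0.
Proof. by rewrite pmulr_rlt0 ?subr_gt0 ?subr_lt0 ?alpha01 ?alpha12. Qed.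

Lemma right_end_lame p : right_end A B p a1.
Proof.
left; have := lame_mid_lt0 => h.
rewrite horner_lameA horner_deriv_lameA horner_lameB subrr.
rewrite !(mul0r, mulr0, add0r, addr0).
by split=> //; rewrite pmulr_rlt0 // mulr_gt0.
Qed.

Lemma left_end_oppr_lame p : left_end (- A) (- B) p a1.
Proof.
left; rewrite derivN !hornerN; have [[->]|[]] := right_end_lame p; last first.
  by rewrite horner_lameA subrr mulr0 mul0r ltxx.
by rewrite oppr0 !oppr_gt0.
Qed.

Lemma right_end_oppr_lame p : right_end (- A) (- B) p a2.
Proof.
left; have h : 0 < (a2 - a0) * (a2 - a1).
  by rewrite mulr_gt0 // subr_gt0 ?alpha12 ?alpha02.
rewrite derivN !hornerN horner_lameA horner_deriv_lameA horner_lameB subrr.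
rewrite !(mul0r, mulr0, add0r, addr0) oppr0 !oppr_lt0.
by split=> //; apply: mulr_gt0 => //; apply: mulr_gt0.
Qed.

Definition stieltjes_poly k nu (phi : {poly R}) :=
  size phi = k.+1 /\ lame_equation alpha rho (lame_mu rho k) nu phi.

Lemma sturm_eq_lame k nu phi : stieltjes_poly k nu phi ->
  sturm_eq A B ('X - nu%:P) (lame_mu rho k) phi.
Proof. by case. Qed.

Lemma sturm_eq_oppr_lame k nu phi : stieltjes_poly k nu phi ->
  sturm_eq (- A) (- B) (nu%:P - 'X) (lame_mu rho k) phi.
Proof.
move=> [_ e]; rewrite /sturm_eq !mulNr -opprD.
by rewrite -[_ - 'X]opprB mulNr scalerN -e.
Qed.

Lemma stieltjes_neq0 k nu phi : stieltjes_poly k nu phi -> phi != 0.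
Proof. by case=> sz _; rewrite -size_poly_eq0 sz. Qed.

Lemma stieltjes_deriv_neq0 k nu phi : (0 < k)%N -> stieltjes_poly k nu phi ->
  phi^`() != 0.
Proof.
move=> k0 [sz _]; apply/eqP => /(congr1 (fun p : {poly R} => p`_k.-1)).
rewrite coef_deriv coef0 prednK // => /eqP; rewrite mulrn_eq0.
rewrite (gtn_eqF k0) -[k in phi`_k]/(k.+1.-1) -sz -/(lead_coef phi) lead_coef_eq0.
by rewrite -size_poly_eq0 sz.
Qed.

Lemma lame_mu_le j k : (j <= k)%N -> lame_mu rho j <= lame_mu rho k.
Proof. by rewrite leq_eqVlt => /orP[/eqP->//|/(lame_mu_lt rho_gt0)/ltW]. Qed.

(** On the left interval [A] is positive, and raising [nu] raises the potential
    [nu - x].  Raising the degree raises [mu], which lowers the leading coefficient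
    [1/mu]; both changes create zeros. *)
Lemma left_zeros_step k k' nu nu' phi psi m : (0 < k)%N -> (k <= k')%N ->
    nu <= nu' -> (k < k')%N || (nu < nu') ->
    stieltjes_poly k nu phi -> stieltjes_poly k' nu' psi ->
  has_zeros phi a0 a1 m -> has_zeros psi a0 a1 m.+1.
Proof.
move=> k0 kk' le_nu strict sphi spsi.
apply: (has_zeros_step (lame_mu_gt0 rho_gt0 k0) (lame_mu_le kk') alpha01 lameA_gt0 _
  (sturm_eq_lame sphi) (sturm_eq_lame spsi) (stieltjes_neq0 sphi)
  (left_end_lame phi) (right_end_lame phi)).
  by move=> x _ _; rewrite !hornerXsubC lerD2l lerN2.
case/orP: strict => h; [right|left].
  by rewrite lame_mu_lt // (stieltjes_deriv_neq0 (leq_trans k0 kk') spsi).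
by move=> x _ _; rewrite !hornerXsubC ltrD2l ltrN2.
Qed.

(** On the right interval [A] is negative, so the roles of the signs are exchanged:
    there zeros are created by lowering [nu]. *)
Lemma right_zeros_step k k' nu nu' phi psi m : (0 < k)%N -> (k <= k')%N ->
    nu' <= nu -> (k < k')%N || (nu' < nu) ->
    stieltjes_poly k nu phi -> stieltjes_poly k' nu' psi ->
  has_zeros phi a1 a2 m -> has_zeros psi a1 a2 m.+1.
Proof.
move=> k0 kk' le_nu strict sphi spsi.
apply: (has_zeros_step (lame_mu_gt0 rho_gt0 k0) (lame_mu_le kk') alpha12 oppr_lameA_gt0 _
  (sturm_eq_oppr_lame sphi) (sturm_eq_oppr_lame spsi) (stieltjes_neq0 sphi)
  (left_end_oppr_lame phi) (right_end_oppr_lame phi)).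
  by move=> x _ _; rewrite !hornerD !hornerN !hornerX !hornerC lerD2r.
case/orP: strict => h; [right|left].
  by rewrite lame_mu_lt // (stieltjes_deriv_neq0 (leq_trans k0 kk') spsi).
by move=> x _ _; rewrite !hornerD !hornerN !hornerX !hornerC ltrD2r.
Qed.

Lemma zeros_le_degree k nu phi m n : stieltjes_poly k nu phi ->
  has_zeros phi a0 a1 m -> has_zeros phi a1 a2 n -> (m + n <= k)%N.
Proof.
move=> sphi [s [<- ps lts rs]] [t [<- pt _ rt]].
have [sz _] := sphi; rewrite -ltnS -sz -size_cat.
apply: max_poly_roots; rewrite ?(stieltjes_neq0 sphi) ?all_cat ?rs //.
rewrite cat_uniq (lt_sorted_uniq (path_sorted ps)).
rewrite (lt_sorted_uniq (path_sorted pt)) andbT.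
apply/hasPn => x xt; apply/negP => /(allP lts) xa1.
have := allP (order_path_min lt_trans pt) _ xt => a1x.
by have := lt_trans xa1 a1x; rewrite ltxx.
Qed.

Lemma has_zeros0 p (a b : R) : has_zeros p a b 0.
Proof. by exists [::]. Qed.

Section Enumerated.
Variables (k : nat) (nu : 'I_k.+1 -> R).
Hypothesis k_gt0 : (0 < k)%N.
Hypothesis nu_incr : forall i j : 'I_k.+1, (i < j)%N -> nu i < nu j.
Hypothesis nuP : forall i, exists phi, stieltjes_poly k (nu i) phi.

Lemma left_zeros_enum (i : 'I_k.+1) phi :
  stieltjes_poly k (nu i) phi -> has_zeros phi a0 a1 i.
Proof.
case: i => i; elim: i phi => [|i IHi] phi ilt sphi; first exact: has_zeros0.
have [psi spsi] := nuP (Ordinal (ltnW ilt)).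
have lt_nu : nu (Ordinal (ltnW ilt)) < nu (Ordinal ilt) by apply: nu_incr => /=.
apply: left_zeros_step k_gt0 (leqnn k) (ltW lt_nu) _ spsi sphi (IHi _ _ spsi).
by rewrite lt_nu orbT.
Qed.

Lemma right_zeros_enum n (i : 'I_k.+1) phi : (i + n)%N = k ->
  stieltjes_poly k (nu i) phi -> has_zeros phi a1 a2 n.
Proof.
elim: n i phi => [|n IHn] i phi ink sphi; first exact: has_zeros0.
have ilt : (i.+1 < k.+1)%N by rewrite -[X in (_ < X.+1)%N]ink -addSnnS ltnS leq_addr.
have [psi spsi] := nuP (Ordinal ilt).
have lt_nu : nu i < nu (Ordinal ilt) by apply: nu_incr => /=.
apply: right_zeros_step k_gt0 (leqnn k) (ltW lt_nu) _ spsi sphi (IHn _ _ _ spsi).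
  by rewrite lt_nu orbT.
by rewrite /= addSnnS.
Qed.

End Enumerated.

(** If [nu] were at most [a0], then comparing [phi] with the constant solution [1] of the
    equation with zero potential would give [1] a zero in the left interval. *)
Lemma van_vleck_gt k nu phi : (0 < k)%N -> stieltjes_poly k nu phi -> a0 < nu.
Proof.
move=> k0 sphi; rewrite ltNge; apply/negP => nua.
have one_eq : sturm_eq A B 0 (lame_mu rho k) 1.
  by rewrite /sturm_eq !(derivSn, derivn0) derivC deriv0 !mulr0 mul0r scaler0 addr0.
have L_gt0 x : a0 < x -> x < a1 -> (0 : {poly R}).[x] < ('X - nu%:P).[x].
  by move=> ax _; rewrite horner0 hornerXsubC subr_gt0 (le_lt_trans nua).
have [x [_ _]] := sturm_picone (lame_mu_gt0 rho_gt0 k0) (lexx _) alpha01 lameA_gt0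
  (fun x ax xb => ltW (L_gt0 x ax xb)) (sturm_eq_lame sphi) one_eq (stieltjes_neq0 sphi)
  (left_end_lame phi) (right_end_lame phi) (or_introl L_gt0).
by rewrite rootC oner_eq0.
Qed.

Lemma van_vleck_lt k nu phi : (0 < k)%N -> stieltjes_poly k nu phi -> nu < a2.
Proof.
move=> k0 sphi; rewrite ltNge; apply/negP => nua.
have one_eq : sturm_eq (- A) (- B) 0 (lame_mu rho k) 1.
  by rewrite /sturm_eq !(derivSn, derivn0) derivC deriv0 !mulr0 mul0r scaler0 addr0.
have L_gt0 x : a1 < x -> x < a2 -> (0 : {poly R}).[x] < (nu%:P - 'X).[x].
  by move=> _ xa; rewrite hornerD hornerN hornerX !hornerC subr_gt0 (lt_le_trans xa).
have [x [_ _]] := sturm_picone (lame_mu_gt0 rho_gt0 k0) (lexx _) alpha12 oppr_lameA_gt0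
  (fun x ax xb => ltW (L_gt0 x ax xb)) (sturm_eq_oppr_lame sphi) one_eq
  (stieltjes_neq0 sphi)
  (left_end_oppr_lame phi) (right_end_oppr_lame phi) (or_introl L_gt0).
by rewrite rootC oner_eq0.
Qed.

Lemma van_vleck_enum_stieltjes k (nu : 'I_k.+1 -> R) : (0 < k)%N ->
  van_vleck_enum alpha rho nu -> forall i, exists phi, stieltjes_poly k (nu i) phi.
Proof.
move=> k0 [_ nuE] i.
have /(van_vleck_zero_real alpha_incr rho_gt0 k0) : van_vleck_zero
    (fun j => (alpha j)%:C%C) (fun j => (rho j)%:C%C) k (nu i)%:C%C.
  by apply/nuE; exists i.
move=> [mu [phi [sz e]]]; exists phi; split=> //.
by rewrite -(lame_equation_mu sz e).
Qed.

(** Counted from zero, the [i]-th solution of degree [k] has at least [i] zeros on the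
    left and [k - i] on the right.  If one of the inequalities failed, the
    corresponding solution of degree [k + 1] would have one more zero than this on one
    side by comparison, one more on the other side by its own index, and so [k + 2]
    zeros in all. *)
Lemma van_vleck_interlace k (nu : 'I_k.+1 -> R) (nu' : 'I_k.+2 -> R) (i : 'I_k.+1) :
    (0 < k)%N -> van_vleck_enum alpha rho nu -> van_vleck_enum alpha rho nu' ->
  nu' (widen_ord (leqnSn k.+1) i) < nu i /\ nu i < nu' (lift ord0 i).
Proof.
move=> k0 enu enu'.
have nuP := van_vleck_enum_stieltjes k0 enu.
have nu'P := van_vleck_enum_stieltjes (ltn0Sn k) enu'.
have [[incr _] [incr' _]] := (enu, enu').
have [phi sphi] := nuP i; have ik : (i + (k - i))%N = k by rewrite subnKC // -ltnS.
have zl := left_zeros_enum k0 incr nuP sphi.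
have zr := right_zeros_enum k0 incr nuP ik sphi.
split; rewrite ltNge; apply/negP => le_nu.
  have [psi spsi] := nu'P (widen_ord (leqnSn k.+1) i).
  have zl' : has_zeros psi a0 a1 i.+1.
    by apply: left_zeros_step k0 (leqnSn k) le_nu _ sphi spsi zl; rewrite ltnSn.
  have zr' : has_zeros psi a1 a2 (k - i).+1.
    by apply: (right_zeros_enum (ltn0Sn k) incr' nu'P _ spsi); rewrite /= addnS ik.
  by have := zeros_le_degree spsi zl' zr'; rewrite addSn addnS ik ltnn.
have [psi spsi] := nu'P (lift ord0 i).
have zl' : has_zeros psi a0 a1 i.+1.
  exact: (left_zeros_enum (ltn0Sn k) incr' nu'P spsi).
have zr' : has_zeros psi a1 a2 (k - i).+1.
  by apply: right_zeros_step k0 (leqnSn k) le_nu _ sphi spsi zr; rewrite ltnSn.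
by have := zeros_le_degree spsi zl' zr'; rewrite addSn addnS ik ltnn.
Qed.

End Interlacing.

Theorem theorem2p1 (R : realType) (alpha rho : 'I_3 -> R) (k : nat)
    (alpha_incr : forall i j : 'I_3, (i < j)%N -> alpha i < alpha j)
    (rho_gt0 : forall j : 'I_3, 0 < rho j)
    (k_gt0 : (0 < k)%N) :
  exists (nu : 'I_k.+1 -> R) (nu' : 'I_k.+2 -> R),
    [/\ van_vleck_enum alpha rho nu,
        van_vleck_enum alpha rho nu',
        alpha ord0 < nu' ord0,
        forall i : 'I_k.+1,
          nu' (widen_ord (leqnSn k.+1) i) < nu i /\ nu i < nu' (lift ord0 i)
      & nu' ord_max < alpha ord_max].
Proof.
have [nu enu] := van_vleck_enum_exists alpha_incr rho_gt0 k_gt0.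
have [nu' enu'] := van_vleck_enum_exists alpha_incr rho_gt0 (ltn0Sn k).
have nu'P := van_vleck_enum_stieltjes alpha_incr rho_gt0 (ltn0Sn k) enu'.
exists nu, nu'; split=> //.
- have [phi] := nu'P ord0; exact: van_vleck_gt.
- move=> i; exact: (van_vleck_interlace alpha_incr rho_gt0).
- have [phi] := nu'P ord_max; exact: van_vleck_lt.
Qed.
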